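(* Let $\kappa$ be an infinite cardinal and $2\leq n<\omega$. Then there is an orientation $D$ of $\mathrm{Sh}_n(\exp_n(\kappa))$ such that for every colouring of the vertices of $D$ with $\kappa$ colours there is a monochromatic copy of $\vec C_4$ in $D$. In particular, $\vec\chi(\mathrm{Sh}_n(\exp_n(\kappa)))>\kappa$.
   Context: $\exp_0(\kappa)=\kappa$ and $\exp_{m+1}(\kappa)=2^{\exp_m(\kappa)}$. For an ordinal $\lambda$, the shift graph $\mathrm{Sh}_n(\lambda)$ has vertex set $[\lambda]^n$ and edges $\{\xi_i:i<n\}\{\xi_j:1\leq j<n+1\}$ for all $\xi_0<\dots<\xi_n<\lambda$. An orientation of an undirected graph $G$ is a digraph on the same vertex set containing, for each edge $uv$ of $G$, exactly one of the arcs $uv$, $vu$, and no other arcs. $\vec C_4$ is the directed 4-cycle; copies need not be induced. $\vec\chi(G)=\sup\{\chi(D): D$ an orientation of $G\}$, where $\chi(D)$ is the minimal number of acyclic vertex sets (sets inducing no directed cycle) covering the vertices of $D$. *)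

(* Defs.v *)
(* Set-theoretic notions encoded with types:
   a cardinal = a type (up to bijection), an ordinal = a well-ordered type. *)
From Stdlib Require Import List Sorted Arith.
Import ListNotations.

Fixpoint expT (m : nat) (K : Type) : Type :=
  match m with
  | 0 => K
  | S m' => expT m' K -> bool
  end.

Definition bijection (A B : Type) : Prop :=
  exists (f : A -> B) (g : B -> A),
    (forall a, g (f a) = a) /\ (forall b, f (g b) = b).

Definition injection (A B : Type) : Prop :=
  exists f : A -> B, forall x y, f x = f y -> x = y.

Definition infinite_type (K : Type) : Prop := injection nat K.

Definition strict_well_order {L : Type} (lt : L -> L -> Prop) : Prop :=
  well_founded lt /\
  (forall x y z, lt x y -> lt y z -> lt x z) /\
  (forall x y, lt x y \/ x = y \/ lt y x).

Definition initial_ordinal {L : Type} (lt : L -> L -> Prop) : Prop :=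
  strict_well_order lt /\
  forall x : L, ~ injection L {y : L | lt y x}.

Definition ShV {L : Type} (lt : L -> L -> Prop) (n : nat) : Type :=
  {s : list L | length s = n /\ Sorted lt s}.

Definition shift_pair {L : Type} (lt : L -> L -> Prop) (n : nat)
  (u v : ShV lt n) : Prop :=
  exists x : list L, length x = S n /\ Sorted lt x /\
    proj1_sig u = removelast x /\ proj1_sig v = tl x.

Definition sh_edge {L : Type} (lt : L -> L -> Prop) (n : nat)
  (u v : ShV lt n) : Prop :=
  shift_pair lt n u v \/ shift_pair lt n v u.

Definition orientation {V : Type} (E : V -> V -> Prop) (D : V -> V -> Prop)
  : Prop :=
  (forall u v, D u v -> E u v) /\
  (forall u v, E u v -> (D u v /\ ~ D v u) \/ (D v u /\ ~ D u v)).

Definition mono_C4 {V K : Type} (D : V -> V -> Prop) (c : V -> K) : Prop :=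
  exists a b d e : V,
    a <> b /\ a <> d /\ a <> e /\ b <> d /\ b <> e /\ d <> e /\
    D a b /\ D b d /\ D d e /\ D e a /\
    c a = c b /\ c a = c d /\ c a = c e.

Fixpoint dpath {V : Type} (D : V -> V -> Prop) (x : V) (l : list V) : Prop :=
  match l with
  | [] => True
  | y :: l' => D x y /\ dpath D y l'
  end.

Definition acyclic_set {V : Type} (D : V -> V -> Prop) (A : V -> Prop) : Prop :=
  ~ exists (v0 : V) (l : list V),
      l <> [] /\ NoDup (v0 :: l) /\ Forall A (v0 :: l) /\
      dpath D v0 l /\ D (last l v0) v0.

Definition dichrom_le {V : Type} (D : V -> V -> Prop) (K : Type) : Prop :=
  exists A : K -> V -> Prop,
    (forall v, exists i, A i v) /\ (forall i, acyclic_set D (A i)).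

(* Main.v *)
(** Write [n = S m], [M = exp_m(kappa)], so that the ordinal has cardinality
    [2^M] and its elements [c] can code all sequences [M -> list L], each
    sequence being coded by [2^M] many [c].  The edge between [a :: z] and
    [z ++ [c]] is oriented forward iff [a :: z] is a term of the sequence coded
    by [c].

    Fix a colouring without monochromatic [C_4].  For a colour [i] and [z] such
    that at least two [a :: z] have colour [i], one finds two of them, [e :: z]
    and [f :: z], such that no [z ++ [c]] of colour [i] comes after [e :: z] and
    before [f :: z].  So if [c] codes a sequence listing [e :: z] but not
    [f :: z], for all colours [i], then at most one [a :: z] has the colour of
    [z ++ [c]].  This is lifted to shorter and shorter tuples: [profile (S j) z]
    records which values of [profile j] are taken rarely on the extensions
    [a :: z], and a value of [profile j] at [z ++ [c]] is always rare.  For the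
    empty tuple it says that [profile m [a] = profile m [c]] for few [a] only.
    It is enough that the sequence coded by [c] treats [M] many tuples, hence
    there are [2^M] many such [c], and they have at most [M] profiles. *)
Require Import Defs.
From Stdlib Require Import List Sorted Arith Lia.
From Stdlib Require Import Classical ClassicalEpsilon FunctionalExtensionality.
Import ListNotations.

(** * Classical decisions and choice *)

Definition decide (P : Prop) : bool :=
  if excluded_middle_informative P then true else false.

Lemma decide_true (P : Prop) : decide P = true <-> P.
Proof.
  unfold decide; destruct (excluded_middle_informative P); split; congruence.
Qed.

Lemma choose_dep {A : Type} {B : A -> Type} (R : forall a, B a -> Prop) :
  (forall a, exists b, R a b) -> exists f : forall a, B a, forall a, R a (f a).
Proof.
  intros H.
  exists (fun a => proj1_sig (constructive_indefinite_description _ (H a))).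
  intros a; apply proj2_sig.
Qed.

(** * Cardinal arithmetic *)

Lemma injection_refl (A : Type) : injection A A.
Proof. exists (fun a => a); auto. Qed.

Lemma injection_trans (A B C : Type) :
  injection A B -> injection B C -> injection A C.
Proof. intros [f Hf] [g Hg]; exists (fun a => g (f a)); auto. Qed.

Lemma injection_prod (A A' B B' : Type) :
  injection A A' -> injection B B' -> injection (A * B) (A' * B').
Proof.
  intros [f Hf] [g Hg]; exists (fun p => (f (fst p), g (snd p))).
  intros [a b] [a' b'] H; simpl in H; injection H; intros.
  f_equal; auto.
Qed.

Lemma injection_fun (X A B : Type) : injection A B -> injection (X -> A) (X -> B).
Proof.
  intros [f Hf]; exists (fun h x => f (h x)); intros h h' H.
  extensionality x; apply Hf; exact (f_equal (fun k => k x) H).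
Qed.

Lemma injection_pow (A B : Type) :
  injection A B -> injection (A -> bool) (B -> bool).
Proof.
  intros [f Hf].
  exists (fun h b => decide (exists a, f a = b /\ h a = true)); intros h h' H.
  assert (E : forall a k, decide (exists a', f a' = f a /\ k a' = true) = k a).
  { intros a k; apply Bool.eq_iff_eq_true; rewrite decide_true; split.
    - intros (a' & Ha & Hk); apply Hf in Ha; congruence.
    - eauto. }
  extensionality a; rewrite <- (E a h), <- (E a h').
  exact (f_equal (fun k => k (f a)) H).
Qed.

Lemma injection_uncurry (A B : Type) :
  injection (A -> B -> bool) (A * B -> bool).
Proof.
  exists (fun h p => h (fst p) (snd p)); intros h h' H.
  extensionality a; extensionality b; exact (f_equal (fun k => k (a, b)) H).
Qed.

Lemma injection_singleton (B : Type) : injection B (B -> bool).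
Proof.
  exists (fun b b' => decide (b = b')); intros b c H.
  symmetry; apply decide_true.
  rewrite <- (f_equal (fun k => k b) H); apply decide_true; reflexivity.
Qed.

Lemma injection_sum_double (A : Type) : injection (A + A) (A * bool).
Proof.
  exists (fun s => match s with inl a => (a, true) | inr a => (a, false) end).
  intros [a|a] [b|b] H; congruence.
Qed.

Lemma pow_square (B : Type) :
  injection (B * bool) B ->
  injection ((B -> bool) * (B -> bool)) (B -> bool).
Proof.
  intros H; apply injection_pow in H; eapply injection_trans; [| exact H].
  exists (fun (p : (B -> bool) * (B -> bool)) (q : B * bool) =>
    if snd q then fst p (fst q) else snd p (fst q)).
  intros [f g] [f' g'] E; f_equal; extensionality b.
  - exact (f_equal (fun k => k (b, true)) E).
  - exact (f_equal (fun k => k (b, false)) E).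
Qed.

Lemma square_double (B : Type) :
  injection bool B -> injection (B * B) B -> injection (B * bool) B.
Proof.
  intros Hb H; eapply injection_trans; [| exact H].
  apply injection_prod; [apply injection_refl | exact Hb].
Qed.

Lemma injection_list (A : Type) :
  injection bool A -> injection (A * A) A -> injection (list A) A.
Proof.
  intros [t Ht] [p Hp].
  exists (fix enc (l : list A) : A :=
            match l with
            | [] => p (t false, t false)
            | a :: l' => p (t true, p (a, enc l'))
            end).
  intros l; induction l as [|a l IH]; intros [|b l'] H; auto;
    apply Hp, pair_equal_spec in H; destruct H as [H1 H2].
  - apply Ht in H1; discriminate.
  - apply Ht in H1; discriminate.
  - apply Hp, pair_equal_spec in H2; destruct H2; f_equal; auto.
Qed.

Lemma left_inverse (A B : Type) (a0 : A) (f : A -> B) :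
  (forall x y, f x = f y -> x = y) -> exists g : B -> A, forall a, g (f a) = a.
Proof.
  intros Hf.
  destruct (choose_dep (fun b a => forall a', f a' = b -> a = a')) as [g Hg].
  - intros b; destruct (classic (exists a, f a = b)) as [[a Ha]|H].
    + exists a; intros a' Ha'; apply Hf; congruence.
    + exists a0; intros a' Ha'; exfalso; eauto.
  - exists g; intros a; apply Hg; reflexivity.
Qed.

(* König's diagonal argument: if every fibre [f^-1(b)] missed some value [t b]
   at coordinate [b], the function [t] itself would be missed. *)
Lemma pigeonhole (B T : Type) (f : (B -> bool) -> B) :
  injection (B -> T) (B -> bool) ->
  exists (b : B) (s : T -> (B -> bool)),
    (forall x y, s x = s y -> x = y) /\ forall t, f (s t) = b.
Proof.
  intros [psi Hpsi]; apply NNPP; intros N.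
  assert (H : forall b, exists t, forall h, f (psi h) = b -> h b <> t).
  { intros b; apply NNPP; intros Nb; apply N.
    destruct (choose_dep (fun t h => f (psi h) = b /\ h b = t)) as [s Hs].
    - intros t; apply NNPP; intros Nt; apply Nb; exists t; intros h E1 E2.
      apply Nt; exists h; auto.
    - exists b, (fun t => psi (s t)); split; [|intros t; apply Hs].
      intros x y E; apply Hpsi in E.
      rewrite <- (proj2 (Hs x)), E; apply Hs. }
  destruct (choose_dep _ H) as [t Ht].
  exact (Ht _ t eq_refl eq_refl).
Qed.

(** * Doubling an infinite well-ordered set *)

Lemma wf_minimal {L : Type} (lt : L -> L -> Prop) (P : L -> Prop) :
  well_founded lt -> (exists x, P x) -> exists x, P x /\ forall y, P y -> ~ lt y x.
Proof.
  intros W [x Hx]; revert Hx; induction (W x) as [x _ IH]; intros Hx.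
  destruct (classic (exists y, P y /\ lt y x)) as [(y & Hy & Hyx)|N].
  - exact (IH y Hyx Hy).
  - exists x; split; auto; intros y Hy Hyx; apply N; eauto.
Qed.

(** Shifting along the embedded natural numbers frees [g 0]; a point sent to [x], if any, is
    redirected there. *)
Lemma infinite_avoid (K : Type) (x : K) :
  infinite_type K ->
  exists h : K -> K, (forall y z, h y = h z -> y = z) /\ forall y, h y <> x.
Proof.
  intros [g Hg].
  destruct (choose_dep (fun y z => (exists m, y = g m /\ z = g (S m)) \/
      (forall m, y <> g m) /\ z = y)) as [h Hh].
  { intros y; destruct (classic (exists m, y = g m)) as [[m E]|N]; eauto.
    exists y; right; split; auto; intros m E; apply N; eauto. }
  assert (Ih : forall y z, h y = h z -> y = z).
  { intros y z E.
    destruct (Hh y) as [(m & -> & E1)|[N1 E1]], (Hh z) as [(k & -> & E2)|[N2 E2]].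
    - rewrite E1, E2 in E; apply Hg in E; congruence.
    - exfalso; apply (N2 (S m)); congruence.
    - exfalso; apply (N1 (S k)); congruence.
    - congruence. }
  assert (H0 : forall y, h y <> g 0).
  { intros y E; destruct (Hh y) as [(m & _ & E1)|[N1 E1]].
    - rewrite E1 in E; apply Hg in E; discriminate.
    - apply (N1 0); congruence. }
  exists (fun y => if excluded_middle_informative (h y = x) then g 0 else h y).
  split.
  - intros y z; destruct (excluded_middle_informative (h y = x)) as [Ey|Ny],
      (excluded_middle_informative (h z = x)) as [Ez|Nz]; intros E.
    + apply Ih; congruence.
    + exfalso; apply (H0 z); congruence.
    + exfalso; apply (H0 y); congruence.
    + auto.
  - intros y; destruct (excluded_middle_informative (h y = x)); auto.
    intros E; apply (H0 y); congruence.
Qed.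

(* Passing to a suitable initial segment [Q] removes the maximum, so every
   element of [Q] is [s^m l] with [l] a limit; then (s^m l, b) |-> s^(2m+b) l. *)
Lemma infinite_double (K : Type) (lt : K -> K -> Prop) :
  strict_well_order lt -> infinite_type K -> injection (K * bool) K.
Proof.
  intros (W & Tr & Tri) Inf.
  assert (Irr : forall x, ~ lt x x).
  { intros x; induction (W x) as [x _ IH]; intros H; exact (IH x H H). }
  pose (P w := exists i : K -> K,
    (forall y z, i y = i z -> y = z) /\ forall k, lt (i k) w).
  (* [Q] is the segment below the least [w] with a copy of [K] below it, or everything if there is
     no such [w]. *)
  pose (Q y := forall w, P w -> lt y w).
  assert (QK : exists i : K -> K,
    (forall y z, i y = i z -> y = z) /\ forall k, Q (i k)).
  { destruct (classic (exists w, P w)) as [E|N].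
    - destruct (wf_minimal lt P W E) as (w & (i & Hi & Hw) & Hm).
      exists i; split; auto; intros k w' Pw'.
      destruct (Tri w w') as [H|[H|H]].
      + eapply Tr; eauto.
      + subst; auto.
      + exfalso; exact (Hm w' Pw' H).
    - exists (fun k => k); split; auto; intros k w Pw; exfalso; eauto. }
  destruct QK as (i & Hi & HiQ).
  (* A greatest [y] of [Q] could be dropped from the copy of [K], giving [P y] and hence
     [lt y y]. *)
  assert (NM : forall y, Q y -> exists z, Q z /\ lt y z).
  { intros y Qy; apply NNPP; intros N; apply (Irr y), Qy.
    assert (Hle : forall k, i k <> y -> lt (i k) y).
    { intros k Hk; destruct (Tri (i k) y) as [H|[H|H]]; auto; try contradiction.
      exfalso; apply N; exists (i k); auto. }
    destruct (classic (exists k0, i k0 = y)) as [[k0 E]|N0].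
    - destruct (infinite_avoid K k0 Inf) as (h & Ih & Hh).
      exists (fun k => i (h k)); split; auto.
      intros k; apply Hle; intros E'; apply (Hh k), Hi; congruence.
    - exists i; split; auto; intros k; apply Hle; eauto. }
  (* [s] is the successor function of [Q]. *)
  destruct (choose_dep (fun y z => Q y ->
      (Q z /\ lt y z) /\ forall z', Q z' /\ lt y z' -> ~ lt z' z)) as [s Hs].
  { intros y; destruct (classic (Q y)) as [Qy|NQ].
    - destruct (wf_minimal lt (fun z => Q z /\ lt y z) W (NM y Qy)) as (z & Hz).
      exists z; auto.
    - exists y; contradiction. }
  assert (Is : forall y z, Q y -> Q z -> s y = s z -> y = z).
  { intros y z Qy Qz E; destruct (Hs y Qy) as [[_ Ly] My], (Hs z Qz) as [[_ Lz] Mz].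
    destruct (Tri y z) as [H|[H|H]]; auto; exfalso.
    - apply (My z); auto; congruence.
    - apply (Mz y); auto; congruence. }
  pose (lim l := Q l /\ forall y, Q y -> s y <> l).
  assert (Dec : forall x, Q x -> exists p : K * nat,
    lim (fst p) /\ x = Nat.iter (snd p) s (fst p)).
  { intros x; induction (W x) as [x _ IH]; intros Qx.
    destruct (classic (exists y, Q y /\ s y = x)) as [(y & Qy & E)|N].
    - destruct (IH y) as ([l m] & Hl & Em); auto.
      { rewrite <- E; apply Hs; auto. }
      exists (l, S m); split; auto; simpl in *; congruence.
    - exists (x, 0); split; auto; split; simpl; auto; intros y Qy E; eauto. }
  destruct (choose_dep (fun x (p : K * nat) => Q x ->
    lim (fst p) /\ x = Nat.iter (snd p) s (fst p))) as [d Hd].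
  { intros x; destruct (classic (Q x)) as [Qx|NQ].
    - destruct (Dec x Qx) as [p Hp]; exists p; auto.
    - exists (x, 0); contradiction. }
  assert (Qi : forall k l, Q l -> Q (Nat.iter k s l)).
  { intros k l Ql; induction k; simpl; auto; apply Hs; auto. }
  assert (U : forall k k' l l', lim l -> lim l' ->
    Nat.iter k s l = Nat.iter k' s l' -> k = k' /\ l = l').
  { induction k as [|k IH]; intros [|k'] l l' [Ql Hl] [Ql' Hl'] E; simpl in E; auto.
    - exfalso; eapply Hl; [|symmetry; exact E]; auto.
    - exfalso; eapply Hl'; [|exact E]; auto.
    - apply Is in E; auto; apply IH in E; unfold lim; intuition. }
  exists (fun p : K * bool => let q := d (i (fst p)) in
    Nat.iter (2 * snd q + (if snd p then 1 else 0)) s (fst q)).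
  intros [k b] [k' b'] E; cbv zeta in E; simpl fst in E; simpl snd in E.
  destruct (Hd (i k) (HiQ k)) as [L1 E1], (Hd (i k') (HiQ k')) as [L2 E2].
  apply U in E; auto; destruct E as [E El].
  assert (Em : snd (d (i k)) = snd (d (i k'))) by (destruct b, b'; lia).
  assert (b = b') by (destruct b, b'; auto; lia).
  f_equal; auto; apply Hi; rewrite E1, E2, Em, El; reflexivity.
Qed.

(** * Iterated powers *)

Lemma infinite_bool (A : Type) : infinite_type A -> injection bool A.
Proof.
  intros H; eapply injection_trans; [| exact H].
  exists (fun b : bool => if b then 1 else 0); intros [] [] E; congruence.
Qed.

Lemma expT_mono (K : Type) (j m : nat) :
  j <= m -> injection (expT j K) (expT m K).
Proof.
  induction 1; [apply injection_refl|].
  eapply injection_trans; [exact IHle | apply injection_singleton].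
Qed.

Lemma expT_infinite (K : Type) (j : nat) :
  infinite_type K -> infinite_type (expT j K).
Proof.
  intros H; apply (injection_trans _ _ _ H), (expT_mono K 0 j), Nat.le_0_l.
Qed.

Lemma expT_double (K : Type) (j : nat) :
  infinite_type K -> injection (K * bool) K ->
  injection (expT j K * bool) (expT j K).
Proof.
  intros Inf H; induction j as [|j IH]; auto.
  apply square_double; [apply infinite_bool, expT_infinite, Inf|].
  apply pow_square, IH.
Qed.

Lemma expT_square (K : Type) (j : nat) :
  infinite_type K -> injection (K * bool) K ->
  injection (expT (S j) K * expT (S j) K) (expT (S j) K).
Proof. intros Inf H; apply pow_square, expT_double; auto. Qed.

Lemma pow_pow (B : Type) :
  injection (B * B) B -> injection (B -> B -> bool) (B -> bool).
Proof.
  intros H; eapply injection_trans; [apply injection_uncurry|].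
  apply injection_pow, H.
Qed.

(** As [L] has size [2^M], this is [(2^M)^M * 2^M = 2^M]; the factor [L] will supply [L] many codes
    for each sequence. *)
Lemma fun_list_injection (M L : Type) :
  infinite_type M -> injection (M * bool) M -> injection (M * M) M ->
  injection L (M -> bool) -> injection (M -> bool) L ->
  injection ((M -> list L) * L) L.
Proof.
  intros Inf D Sq LP PL.
  assert (SqL : injection (L * L) L).
  { eapply injection_trans; [apply injection_prod; exact LP|].
    eapply injection_trans; [apply pow_square, D | exact PL]. }
  eapply injection_trans; [|exact SqL].
  apply injection_prod; [|apply injection_refl].
  eapply injection_trans.
  { apply injection_fun, injection_list, SqL.
    eapply injection_trans; [apply infinite_bool, Inf|].
    eapply injection_trans; [apply injection_singleton | exact PL]. }
  eapply injection_trans; [apply injection_fun, LP|].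
  eapply injection_trans; [apply pow_pow, Sq | exact PL].
Qed.

(** * Large subsets and their enumeration *)

Definition copy {L : Type} (T : Type) (A : L -> Prop) : Prop :=
  exists s : T -> L, (forall x y, s x = s y -> x = y) /\ forall t, A (s t).

Lemma copy_mono {L T : Type} (A B : L -> Prop) :
  (forall a, A a -> B a) -> copy T A -> copy T B.
Proof. intros H (s & Is & As); exists s; auto. Qed.

Lemma copy_injection {L S T : Type} (A : L -> Prop) :
  injection S T -> copy T A -> copy S A.
Proof.
  intros [f If] (s & Is & As); exists (fun x => s (f x)); auto.
Qed.

Lemma enumerate (I W M : Type) (i0 : I) (f : I -> W) :
  injection I M -> exists r : M -> W, forall w, (exists m, r m = w) <-> exists i, f i = w.
Proof.
  intros [e Ie]; destruct (left_inverse _ _ i0 e Ie) as [g Hg].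
  exists (fun m => f (g m)); intros w; split; intros [x E]; eauto.
  exists (e x); rewrite Hg; exact E.
Qed.

(** A single [h] serves all [i]: it runs through one chosen copy of [T] in each [A i] that has any,
    which takes at most [I * T] values. *)
Lemma enumerate_copies (I T M L : Type) (i0 : I) (t0 : T) (l0 : L)
  (A : I -> L -> Prop) :
  injection (I * T) M ->
  exists h : M -> L, forall i, copy T (A i) ->
    copy T (fun a => A i a /\ exists m, h m = a).
Proof.
  intros E.
  destruct (choose_dep (fun i (s : T -> L) => copy T (A i) ->
    (forall x y, s x = s y -> x = y) /\ forall t, A i (s t))) as [s Hs].
  { intros i; destruct (classic (copy T (A i))) as [[s H]|N].
    - exists s; auto.
    - exists (fun _ => l0); contradiction. }
  destruct (enumerate _ _ _ (i0, t0) (fun p => s (fst p) (snd p)) E) as [h Hh].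
  exists h; intros i C; exists (s i); split; [apply Hs, C|].
  intros t; split; [apply Hs, C|].
  apply Hh; exists (i, t); reflexivity.
Qed.

(** Doubling gives two disjoint copies of [L] in [L]; [s] sends at least one of them strictly below
    [x], against initiality. *)
Lemma initial_no_copy {L : Type} (lt : L -> L -> Prop) (x : L) :
  initial_ordinal lt -> injection (L * bool) L -> ~ copy L (fun y => ~ lt x y).
Proof.
  intros [(_ & _ & Tri) Ini] [d Id] (s & Is & Hs); apply (Ini x).
  assert (E : exists s' : L -> L,
    (forall y z, s' y = s' z -> y = z) /\ forall y, lt (s' y) x).
  { assert (Lt : forall y, s y <> x -> lt (s y) x).
    { intros y N; destruct (Tri (s y) x) as [H|[H|H]]; auto; try contradiction.
      exfalso; exact (Hs y H). }
    destruct (classic (exists y0, s (d (y0, false)) = x)) as [[y0 E]|N].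
    - exists (fun y => s (d (y, true))); split.
      + intros y z H; apply Is, Id in H; congruence.
      + intros y; apply Lt; rewrite <- E; intros H; apply Is, Id in H; congruence.
    - exists (fun y => s (d (y, false))); split.
      + intros y z H; apply Is, Id in H; congruence.
      + intros y; apply Lt; eauto. }
  destruct E as (s' & Is' & Hs').
  exists (fun y => exist (fun z => lt z x) (s' y) (Hs' y)); intros y z H.
  apply Is', (f_equal (@proj1_sig _ _) H).
Qed.

(** * Profiles of a colouring *)

(* A set of extensions counts as large at level [j] when it contains a copy of
   [test K j]; by [expT_pigeonhole] this is tuned so that colouring
   [expT (S j) K] with [expT j K] colours yields a large fibre. *)
Definition test (K : Type) (j : nat) : Type :=
  match j with
  | 0 => bool
  | S _ => expT j K
  end.

Fixpoint profile {K L : Type} (lt : L -> L -> Prop) (col : list L -> K) (j : nat)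
  : list L -> expT j K :=
  match j with
  | 0 => col
  | S j' => fun z i =>
      decide (~ copy (test K j')
                (fun a => Sorted lt (a :: z) /\ profile lt col j' (a :: z) = i))
  end.

(** The set measured in [profile]: level [S j] marks [i] as rare at [z] iff this set holds no copy
    of [test K j]. *)
Definition fibre {K L : Type} (lt : L -> L -> Prop) (col : list L -> K) (j : nat)
  (z : list L) (i : expT j K) (a : L) : Prop :=
  Sorted lt (a :: z) /\ profile lt col j (a :: z) = i.

Lemma test_inhabited (K : Type) (j : nat) : inhabited (test K j).
Proof. destruct j as [|j]; constructor; [exact true | exact (fun _ => true)]. Qed.

(** For König's argument, [test K j] to the power [expT j K] must not exceed [expT (S j) K]; for
    [j > 0] this follows from squaring. *)
Lemma expT_pigeonhole (K : Type) (j : nat) (f : expT (S j) K -> expT j K) :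
  infinite_type K -> injection (K * bool) K ->
  exists b (s : test K j -> expT (S j) K),
    (forall x y, s x = s y -> x = y) /\ forall t, f (s t) = b.
Proof.
  intros Inf D; apply pigeonhole; destruct j as [|j]; [apply injection_refl|].
  eapply injection_trans; [apply injection_fun, injection_singleton|].
  apply pow_pow, expT_square; auto.
Qed.

Lemma test_expT (K : Type) (j : nat) :
  infinite_type K -> injection (K * bool) K ->
  injection (expT j K * test K j) (expT j K).
Proof.
  intros Inf D; destruct j as [|j]; [exact D | apply expT_square; auto].
Qed.

Lemma Sorted_cons_app {L : Type} (lt : L -> L -> Prop) (a c : L) (z : list L) :
  Sorted lt (a :: z) -> Sorted lt (z ++ [c]) -> (z = [] -> lt a c) ->
  Sorted lt (a :: z ++ [c]).
Proof.
  intros H1 H2 H3; constructor; auto.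
  destruct z as [|b z]; simpl; constructor; auto.
  apply Sorted_inv in H1; destruct H1 as [_ H]; inversion H; auto.
Qed.

(* If [profile (S j)] of [a :: z] is the same set [T] for all [a] in a copy of
   [expT (S j) K], then, inductively, [profile j (a :: z ++ [c])] lies in [T] for
   all of them, and by pigeonhole takes some value in [T] too often. *)
Lemma profile_descent (K L : Type) (lt : L -> L -> Prop) (col : list L -> K)
  (n : nat) (c : L) (X : list L -> Prop) :
  infinite_type K -> injection (K * bool) K ->
  (forall j z i, X z -> length z + j = n ->
    copy (test K j) (fibre lt col j z i) ->
    copy (test K j) (fun a => fibre lt col j z i a /\ X (a :: z))) ->
  (forall z, X z -> length z = n -> Sorted lt (z ++ [c]) ->
    ~ copy bool (fibre lt col 0 z (col (z ++ [c])))) ->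
  (forall a, X [a] -> lt a c) ->
  forall j z, X z -> length z + j = n -> Sorted lt (z ++ [c]) ->
    ~ copy (test K j) (fibre lt col j z (profile lt col j (z ++ [c]))).
Proof.
  intros Inf D HX H0 Hc j; induction j as [|j IH]; intros z Xz Ez Sz C.
  { apply (H0 z) in C; auto; lia. }
  apply HX in C; auto; destruct C as (s & Is & Hs).
  assert (Sc : forall t, Sorted lt (s t :: z ++ [c])).
  { intros t; destruct (Hs t) as [[S1 _] X1]; apply Sorted_cons_app; auto.
    intros ->; auto. }
  assert (P : forall t, profile lt col (S j) (z ++ [c])
                          (profile lt col j (s t :: z ++ [c])) = true).
  { intros t; destruct (Hs t) as [[S1 E1] X1]; rewrite <- E1.
    apply decide_true, (IH (s t :: z)); simpl; auto; lia. }
  destruct (expT_pigeonhole K j (fun t => profile lt col j (s t :: z ++ [c])) Inf D)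
    as (b & u & Iu & Hu).
  destruct (test_inhabited K j) as [t0].
  specialize (P (u t0)); rewrite Hu in P.
  apply (proj1 (decide_true _)) in P; apply P.
  exists (fun t => s (u t)); auto.
Qed.

(** The tuples reached from the empty one by prepending values of [g], a family no larger than
    [list M]. *)
Fixpoint path {M L : Type} (g : list L -> M -> L) (p : list M) : list L :=
  match p with
  | [] => []
  | m :: p' => g (path g p') m :: path g p'
  end.

(** * The orientation *)

(** [R c w] will mean that [w] is a term of the sequence coded by [c], the last entry of [v]. *)
Definition forward {L : Type} (lt : L -> L -> Prop) (n : nat)
  (R : L -> list L -> Prop) (u v : ShV lt n) : Prop :=
  shift_pair lt n u v /\
  exists z c, proj1_sig v = z ++ [c] /\ R c (proj1_sig u).

Definition arc {L : Type} (lt : L -> L -> Prop) (n : nat)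
  (R : L -> list L -> Prop) (u v : ShV lt n) : Prop :=
  forward lt n R u v \/ (shift_pair lt n v u /\ ~ forward lt n R v u).

(** The increase of the first entry is what rules out shifts in both directions. *)
Lemma shift_pair_hd {L : Type} (lt : L -> L -> Prop) (n : nat) (u v : ShV lt n) :
  1 <= n -> shift_pair lt n u v ->
  exists a b s t, proj1_sig u = a :: s /\ proj1_sig v = b :: t /\ lt a b.
Proof.
  intros Hn (x & Hx & Sx & Eu & Ev).
  destruct x as [|a [|b x]]; simpl in Hx; try lia.
  apply Sorted_inv in Sx; destruct Sx as [_ H]; inversion H; subst.
  destruct u as [u [lu su]]; simpl in *; subst u.
  exists a, b, (removelast (b :: x)), x; auto.
Qed.

Lemma well_order_asym {L : Type} (lt : L -> L -> Prop) (x y : L) :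
  strict_well_order lt -> lt x y -> ~ lt y x.
Proof.
  intros (W & Tr & _) H H'; assert (E : lt x x) by eauto.
  clear y H H'; induction (W x) as [x _ IH]; exact (IH x E E).
Qed.

Lemma shift_pair_asym {L : Type} (lt : L -> L -> Prop) (n : nat) (u v : ShV lt n) :
  strict_well_order lt -> 1 <= n -> shift_pair lt n u v -> ~ shift_pair lt n v u.
Proof.
  intros W Hn H H'; apply shift_pair_hd in H, H'; auto.
  destruct H as (a & b & s & t & E1 & E2 & H).
  destruct H' as (a' & b' & s' & t' & E1' & E2' & H').
  apply (well_order_asym lt a b W H); congruence.
Qed.

Lemma arc_orientation {L : Type} (lt : L -> L -> Prop) (n : nat)
  (R : L -> list L -> Prop) :
  strict_well_order lt -> 1 <= n -> orientation (sh_edge lt n) (arc lt n R).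
Proof.
  intros W Hn.
  assert (As := fun u v => shift_pair_asym lt n u v W Hn).
  split; unfold sh_edge, arc, forward; intros u v.
  - intuition.
  - intros [H|H]; assert (H' := As _ _ H); tauto.
Qed.

Lemma vertex {L : Type} (lt : L -> L -> Prop) (n : nat) (s : list L) :
  length s = n -> Sorted lt s -> exists v : ShV lt n, proj1_sig v = s.
Proof. intros H1 H2; exists (exist _ s (conj H1 H2)); reflexivity. Qed.

Lemma shift_pair_cons {L : Type} (lt : L -> L -> Prop) (n : nat) (u v : ShV lt n)
  (a c : L) (z : list L) :
  proj1_sig u = a :: z -> proj1_sig v = z ++ [c] -> Sorted lt (a :: z ++ [c]) ->
  shift_pair lt n u v.
Proof.
  intros Eu Ev Hs; exists (a :: z ++ [c]); split; [|split; [auto|split]].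
  - destruct v as [v [lv sv]]; simpl in *; subst; auto.
  - rewrite Eu, app_comm_cons, removelast_last; reflexivity.
  - rewrite Ev; reflexivity.
Qed.

Lemma forward_cons {L : Type} (lt : L -> L -> Prop) (n : nat)
  (R : L -> list L -> Prop) (u v : ShV lt n) (a c : L) (z : list L) :
  proj1_sig u = a :: z -> proj1_sig v = z ++ [c] -> Sorted lt (a :: z ++ [c]) ->
  forward lt n R u v <-> R c (a :: z).
Proof.
  intros Eu Ev Hs; unfold forward; rewrite Eu; split.
  - intros [_ (z' & c' & E & H)]; rewrite Ev in E.
    apply app_inj_tail in E; destruct E; subst; auto.
  - intros H; split; [eapply shift_pair_cons; eauto|]; eauto.
Qed.

(** * Finding a monochromatic 4-cycle *)

(** The cycle is [e :: z], [z ++ [c1]], [f :: z], [z ++ [c2]]: the terms listed by [c1] and [c2]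
    give its two forward arcs, the terms not listed its two backward ones. *)
Lemma mono_C4_intro {K L : Type} (lt : L -> L -> Prop) (n : nat)
  (R : L -> list L -> Prop) (col : list L -> K) (z : list L) (i : K)
  (e f c1 c2 : L) :
  strict_well_order lt -> z <> [] -> S (length z) = n ->
  Sorted lt (e :: z) -> Sorted lt (f :: z) ->
  Sorted lt (z ++ [c1]) -> Sorted lt (z ++ [c2]) ->
  col (e :: z) = i -> col (f :: z) = i -> col (z ++ [c1]) = i -> col (z ++ [c2]) = i ->
  R c1 (e :: z) -> ~ R c1 (f :: z) -> R c2 (f :: z) -> ~ R c2 (e :: z) ->
  mono_C4 (arc lt n R) (fun v => col (proj1_sig v)).
Proof.
  intros W Hz Hn Se Sf S1 S2 Ce Cf C1 C2 R1e R1f R2f R2e.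
  assert (Lz : forall c, length (z ++ [c]) = n)
    by (intros; rewrite length_app; simpl; lia).
  destruct (vertex lt n (e :: z)) as [ve Ee]; auto.
  destruct (vertex lt n (f :: z)) as [vf Ef]; auto.
  destruct (vertex lt n (z ++ [c1])) as [v1 E1]; auto.
  destruct (vertex lt n (z ++ [c2])) as [v2 E2]; auto.
  assert (Full : forall a c, Sorted lt (a :: z) -> Sorted lt (z ++ [c]) ->
    Sorted lt (a :: z ++ [c])).
  { intros; apply Sorted_cons_app; auto; contradiction. }
  assert (Ne : forall (u v : ShV lt n) a c,
    proj1_sig u = a :: z -> proj1_sig v = z ++ [c] ->
    Sorted lt (a :: z) -> Sorted lt (z ++ [c]) -> u <> v).
  { intros u v a c Eu Ev Su Sv E; subst v.
    assert (H : shift_pair lt n u u) by (eapply shift_pair_cons; eauto).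
    revert H; apply shift_pair_asym; auto; [lia|]; eapply shift_pair_cons; eauto. }
  assert (F1e := forward_cons lt n R ve v1 e c1 z Ee E1 (Full _ _ Se S1)).
  assert (F1f := forward_cons lt n R vf v1 f c1 z Ef E1 (Full _ _ Sf S1)).
  assert (F2e := forward_cons lt n R ve v2 e c2 z Ee E2 (Full _ _ Se S2)).
  assert (F2f := forward_cons lt n R vf v2 f c2 z Ef E2 (Full _ _ Sf S2)).
  exists ve, v1, vf, v2; rewrite Ee, Ef, E1, E2.
  repeat split; try congruence.
  - eapply Ne; eauto.
  - eapply Ne; eauto.
  - apply not_eq_sym; eapply Ne; eauto.
  - intros E; subst v2; rewrite E1 in E2; apply app_inj_tail in E2.
    destruct E2; subst; contradiction.
  - eapply Ne; eauto.
  - left; tauto.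
  - right; split; [eapply shift_pair_cons; eauto | tauto].
  - left; tauto.
  - right; split; [eapply shift_pair_cons; eauto | tauto].
Qed.

Lemma mono_C4_exists (K L : Type) (lt : L -> L -> Prop) (n : nat)
  (code : L -> expT n K -> list L) (col : list L -> K) :
  infinite_type K -> injection (K * bool) K ->
  initial_ordinal lt -> 1 <= n ->
  injection L (expT (S n) K) -> injection (expT (S n) K) L ->
  (forall r, copy L (fun c => code c = r)) ->
  mono_C4 (arc lt (S n) (fun c w => exists m, code c m = w))
    (fun v => col (proj1_sig v)).
Proof.
  intros Inf D Ini Hn LP PL Hcode; apply NNPP; intros N.
  assert (W : strict_well_order lt) by apply Ini.
  set (R := fun c w => exists m, code c m = w) in N.
  assert (InfM := expT_infinite K n Inf).
  assert (DM := expT_double K n Inf D).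
  assert (SqM : injection (expT n K * expT n K) (expT n K)).
  { destruct n as [|n]; [lia | apply expT_square; auto]. }
  assert (DL : injection (L * bool) L).
  { eapply injection_trans; [apply injection_prod; [exact LP | apply injection_refl]|].
    eapply injection_trans; [apply expT_double; auto | exact PL]. }
  destruct PL as [u Iu]; set (l0 := u (fun _ => true)).
  (* The values of [h] meet every large fibre over [z] in a large set; the length of [z] fixes the
     level [j]. *)
  assert (Sel : forall z, exists h : expT n K -> L, forall j i, length z + j = n ->
    copy (test K j) (fibre lt col j z i) ->
    copy (test K j) (fun a => fibre lt col j z i a /\ exists m, h m = a)).
  { intros z; destruct (le_lt_dec (length z) n) as [H|H].
    - destruct (test_inhabited K (n - length z)) as [t0].
      destruct (expT_infinite K (n - length z) Inf) as [i0 _].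
      destruct (enumerate_copies (expT (n - length z) K) (test K (n - length z))
        (expT n K) L (i0 0) t0 l0 (fibre lt col (n - length z) z)) as [h Hh].
      { eapply injection_trans; [apply test_expT; auto | apply expT_mono; lia]. }
      exists h; intros j i E; assert (j = n - length z) by lia; subst j; apply Hh.
    - exists (fun _ => l0); intros; lia. }
  destruct (choose_dep _ Sel) as [g Hg]; clear Sel.
  (* For a query [(z, i)], [w] is the tuple [e :: z] to be listed; the empty list marks queries
     without two candidates. *)
  assert (Sep : forall q : list L * K, exists w : list L,
    (copy bool (fibre lt col 0 (fst q) (snd q)) -> exists e f, e <> f /\
       w = e :: fst q /\ col (e :: fst q) = snd q /\ col (f :: fst q) = snd q /\
       (length (fst q) = n -> forall c, Sorted lt (fst q ++ [c]) ->
        col (fst q ++ [c]) = snd q -> R c (e :: fst q) -> R c (f :: fst q))) /\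
    (~ copy bool (fibre lt col 0 (fst q) (snd q)) -> w = [])).
  { intros [z i]; simpl fst; simpl snd.
    destruct (classic (copy bool (fibre lt col 0 z i))) as [C|C];
      [|exists []; tauto].
    assert (C' := C); destruct C' as (s & Is & Hs).
    destruct (Hs true) as [S1 E1], (Hs false) as [S2 E2]; simpl in E1, E2.
    assert (s true <> s false) by (intros E; apply Is in E; discriminate).
    destruct (classic (length z = n -> forall c, Sorted lt (z ++ [c]) ->
      col (z ++ [c]) = i -> R c (s true :: z) -> R c (s false :: z))) as [H1|H1].
    { exists (s true :: z); split; [intros _; exists (s true), (s false) | tauto].
      auto. }
    (* If both orders of the two candidates failed, the witnesses [c'] and [c] would close a
       monochromatic cycle. *)
    exists (s false :: z); split; [intros _; exists (s false), (s true) | tauto].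
    repeat split; auto; intros Lz c Sc Ec R1; apply NNPP; intros R2.
    apply H1; intros _ c' Sc' Ec' R1'; apply NNPP; intros R2'.
    apply N; apply (mono_C4_intro lt (S n) R col z i (s true) (s false) c' c); auto.
    intros ->; simpl in Lz; lia. }
  destruct (choose_dep _ Sep) as [w Hw]; clear Sep.
  destruct (expT_infinite K 0 Inf) as [k0 _]; simpl in k0.
  (* [r] lists the answers to all queries on tuples reached by [path], of which there are at most
     [expT n K]. *)
  destruct (enumerate (list (expT n K) * K) (list L) (expT n K) ([], k0 0)
    (fun q => w (path g (fst q), snd q))) as [r Hr].
  { eapply injection_trans; [|exact SqM].
    apply injection_prod; [|apply (expT_mono K 0); lia].
    apply injection_list; auto; apply infinite_bool; auto. }
  destruct (Hcode r) as (s & Is & Hs).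
  set (X z := exists p, path g p = z).
  assert (G0 : forall l z, X z -> length z = n -> Sorted lt (z ++ [s l]) ->
    ~ copy bool (fibre lt col 0 z (col (z ++ [s l])))).
  { intros l z [p Ep] Lz Sz C.
    destruct (Hw (z, col (z ++ [s l]))) as [H _]; simpl fst in H; simpl snd in H.
    destruct (H C) as (e & f & Nef & Ew & Ee & Ef & Sepf); clear H.
    (* The code lists [e :: z], hence also [f :: z]. The query answered by [f :: z] has the same
       tuple and colour, so its answer is [e :: z] too, and [e = f]. *)
    destruct (Sepf Lz (s l) Sz eq_refl) as [m Em].
    - unfold R; rewrite Hs; apply Hr.
      exists (p, col (z ++ [s l])); simpl; rewrite Ep; exact Ew.
    - rewrite Hs in Em; destruct (proj1 (Hr _) (ex_intro _ m Em)) as [[p' i'] E'].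
      simpl in E'; destruct (Hw (path g p', i')) as [H1 H2]; simpl fst in *; simpl snd in *.
      destruct (classic (copy bool (fibre lt col 0 (path g p') i'))) as [C'|C'].
      + destruct (H1 C') as (e' & f' & _ & Ew' & Ee' & _).
        rewrite E' in Ew'; injection Ew'; intros Ez Efe.
        apply Nef; rewrite <- Ez in *; subst e'.
        assert (i' = col (z ++ [s l])) by congruence.
        congruence.
      + rewrite (H2 C') in E'; discriminate. }
  (* Each code is classified by some [g [] m] not below it or, failing that, by its profile. With at
     most [expT n K] classes, one of them has [expT (S n) K] members. *)
  destruct (choose_dep (fun y (o : expT n K + expT n K) => match o with
    | inl m => ~ lt (g [] m) (s (u y))
    | inr i => (forall m, lt (g [] m) (s (u y))) /\ profile lt col n [s (u y)] = i
    end)) as [F HF].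
  { intros y; destruct (classic (exists m, ~ lt (g [] m) (s (u y)))) as [[m H]|H].
    - exists (inl m); auto.
    - exists (inr (profile lt col n [s (u y)])); split; auto.
      intros m; apply NNPP; eauto. }
  destruct (injection_trans _ _ _ (injection_sum_double _) DM) as [q Iq].
  destruct (pigeonhole (expT n K) (expT (S n) K) (fun y => q (F y)))
    as (b & v & Iv & Hv).
  { apply pow_pow; auto. }
  set (c := s (u (v (fun _ => true)))).
  assert (E : forall t, F (v t) = F (v (fun _ => true))).
  { intros t; apply Iq; rewrite !Hv; reflexivity. }
  destruct (F (v (fun _ => true))) as [m|i] eqn:E0.
  - apply (initial_no_copy lt (g [] m) Ini DL), (copy_injection _ LP).
    exists (fun t => s (u (v t))); split; auto.
    intros t; specialize (HF (v t)); rewrite E in HF; exact HF.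
  - assert (HFt : forall t, (forall m, lt (g [] m) (s (u (v t)))) /\
      profile lt col n [s (u (v t))] = i).
    { intros t; specialize (HF (v t)); rewrite E in HF; exact HF. }
    (* All codes of the class share the profile of [c], so this value is not rare at the empty
       tuple. *)
    apply (profile_descent K L lt col n c X Inf D) with (j := n) (z := []).
    + intros j z i' [p Ep] Lz C.
      apply (copy_mono (fun a => fibre lt col j z i' a /\ exists m, g z m = a)).
      * intros a [Ha [m Em]]; split; auto.
        exists (m :: p); simpl; rewrite Ep, Em; reflexivity.
      * apply Hg; auto.
    + apply G0.
    + intros a [p Ep]; destruct p as [|m [|m' p]]; try discriminate.
      injection Ep; intros <-; apply HFt.
    + exists []; reflexivity.
    + reflexivity.
    + repeat constructor.
    + destruct n as [|n']; [lia|].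
      apply (copy_injection (T := expT (S (S n')) K)); [apply injection_singleton|].
      exists (fun t => s (u (v t))); split; auto.
      intros t; split; [repeat constructor|].
      etransitivity; [apply HFt | symmetry; apply HFt].
Qed.

(** * The dichromatic number and the conclusion *)

(** Given a cover by acyclic sets, colour each vertex by a set containing it; a monochromatic
    4-cycle lies in one of them. *)
Lemma C4_not_acyclic {V K : Type} (D : V -> V -> Prop) :
  (forall c : V -> K, mono_C4 D c) -> ~ dichrom_le D K.
Proof.
  intros H (A & Cov & Acy).
  destruct (choose_dep _ Cov) as [c Hc].
  destruct (H c) as (a & b & d & e & Nab & Nad & Nae & Nbd & Nbe & Nde &
    Dab & Dbd & Dde & Dea & Eb & Ed & Ee).
  apply (Acy (c a)); exists a, [b; d; e]; split; [discriminate|].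
  split; [|split; [|simpl; auto]].
  - repeat constructor; simpl; intuition.
  - repeat constructor; auto; [rewrite Eb | rewrite Ed | rewrite Ee]; auto.
Qed.

Lemma pullback_well_order {A B : Type} (lt : B -> B -> Prop) (f : A -> B) :
  (forall x y, f x = f y -> x = y) -> strict_well_order lt ->
  strict_well_order (fun x y => lt (f x) (f y)).
Proof.
  intros If (W & Tr & Tri); split; [|split].
  - intros x; remember (f x) as b eqn:E; revert x E.
    induction (W b) as [b _ IH]; intros x ->; constructor; intros y H; eauto.
  - eauto.
  - intros x y; destruct (Tri (f x) (f y)) as [H|[H|H]]; auto.
Qed.

Theorem theorem4p5 :
  forall (K : Type) (n : nat) (L : Type) (lt : L -> L -> Prop),
    infinite_type K ->
    2 <= n ->
    initial_ordinal lt ->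
    bijection L (expT n K) ->
    exists D : ShV lt n -> ShV lt n -> Prop,
      orientation (sh_edge lt n) D /\
      (forall c : ShV lt n -> K, mono_C4 D c) /\
      ~ dichrom_le D K.
Proof.
  intros K n L lt Inf Hn Ini (f & g & gf & fg).
  destruct n as [|n]; [lia|].
  assert (LP : injection L (expT (S n) K)) by (exists f; congruence).
  assert (PL : injection (expT (S n) K) L) by (exists g; congruence).
  assert (W : strict_well_order lt) by apply Ini.
  (* [K] embeds in [L] and inherits the well-order that doubling requires. *)
  assert (D : injection (K * bool) K).
  { destruct (injection_trans _ _ _ (expT_mono K 0 (S n) (Nat.le_0_l _)) PL) as [h Ih].
    apply (infinite_double K (fun x y => lt (h x) (h y))); auto.
    apply pullback_well_order; auto. }
  destruct (fun_list_injection (expT n K) L) as [e Ie]; auto.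
  { apply expT_infinite, Inf. }
  { apply expT_double; auto. }
  { destruct n as [|n]; [lia | apply expT_square; auto]. }
  destruct (left_inverse _ _ (fun _ => [], g (fun _ => true)) e Ie) as [d Hd].
  set (code c := fst (d c)).
  exists (arc lt (S n) (fun c w => exists m, code c m = w)).
  split; [apply arc_orientation; auto; lia|].
  assert (C4 : forall c : ShV lt (S n) -> K,
    mono_C4 (arc lt (S n) (fun c w => exists m, code c m = w)) c).
  { intros c; destruct Inf as [k0 Ik0].
    (* The colouring is extended to all lists, with [k0 0] on those that are not vertices. *)
    destruct (choose_dep (fun s k => forall v : ShV lt (S n), proj1_sig v = s -> c v = k))
      as [col Hcol].
    { intros s; destruct (classic (exists v : ShV lt (S n), proj1_sig v = s))
        as [[v E]|N]; [exists (c v) | exists (k0 0)]; intros v' E'.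
      - f_equal; destruct v as [v Hv], v' as [v' Hv']; simpl in *; subst v v'.
        f_equal; apply proof_irrelevance.
      - exfalso; eauto. }
    replace c with (fun v : ShV lt (S n) => col (proj1_sig v)).
    - apply mono_C4_exists; auto; [exists k0; auto | lia |].
      intros r; exists (fun l => e (r, l)); split.
      + intros x y E; apply Ie in E; congruence.
      + intros l; unfold code; rewrite Hd; reflexivity.
    - extensionality v; symmetry; apply Hcol; reflexivity. }
  split; [exact C4 | apply C4_not_acyclic, C4].
Qed.
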